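(* Let $r\in\{2,3,4,5\}$. For every finite biclique $[X,Y]$ and every coloring of its edges with $r$ colors, there is a collection of at most $2r-2$ monochromatic components whose vertex sets together cover $X\cup Y$.
   Context: A biclique $[X,Y]$ is a complete bipartite graph with nonempty vertex classes $X$ and $Y$. Given an edge coloring, a monochromatic component is a connected component of the subgraph formed by the edges of any one given color. All graphs are finite. *)

(* Defs.v *)
From mathcomp Require Import all_boot.

Set Implicit Arguments.
Unset Strict Implicit.
Unset Printing Implicit Defensive.

(* The biclique [X,Y] is encoded by two nonempty finite types: its vertex type
   is X + Y, its edges are the pairs (x, y), and an edge coloring with r colors
   is an arbitrary (not necessarily surjective) function c : X -> Y -> 'I_r. *)
Definition mono_adj (X Y : finType) (r : nat) (c : X -> Y -> 'I_r) (i : 'I_r) :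
    rel (X + Y)%type :=
  fun u v => match u, v with
             | inl x, inr y => c x y == i
             | inr y, inl x => c x y == i
             | _, _ => false
             end.

(* The graph formed by a set of edges has as vertices only the endpoints of
   those edges, hence the condition that v has a neighbour: a vertex incident
   with no edge of color i is not a component in color i. *)
Definition edge_component (T : finType) (e : rel T) (A : {set T}) : Prop :=
  exists2 v : T, (exists w : T, e v w) & A = [set u | connect e v u].

Definition mono_component (X Y : finType) (r : nat) (c : X -> Y -> 'I_r)
    (A : {set X + Y}) : Prop :=
  exists i : 'I_r, edge_component (mono_adj c i) A.

(* Main.v *)
(* Label every vertex, in each color i, by its component: x has labels f x i, y
   has labels g y i, and any x, y agree in some color.  Suppose no 2r-2 labels
   cover everything.  The labels of x cover Y and those of y cover X, 2r-1 in
   all; any further coincidence saves one.  So x and y agree in exactly one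
   color, every color class is spanning (hence has t > 2r-2 components), no
   X- or Y-block of a component properly contains one of another color, and no
   component has its X-block as a block of another color and also its Y-block.

   For a color i, the matrix of the products over j <> i of z(f x j) - z(g y j),
   with indeterminate z, has rank at most 2^(r-1) and is block diagonal along
   the components of color i.  A block has rank at least 2 if it is thick, i.e.
   some f _ j and g _ j are both nonconstant on it.  Hence
   t + #thick <= 2^(r-1), which is impossible for r <= 3 and leaves two
   components that are not thick for r = 4, 5.  By the antichain property each
   of these has its X-block, or its Y-block, common to all colors, and both
   have the same kind, say B and C are Y-blocks of all colors.  Every x has B
   and C among its blocks, so Y minus B and C is split by x into at most three
   blocks; as t - 2 > r, two such x with different color-i blocks agree with a
   fixed y in the same other color, and comparing their splittings contradicts
   the antichain property. *)
Require Import Defs.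
From mathcomp Require Import all_boot all_algebra.
From mathcomp Require mpoly.
From mathcomp Require Import zify ring.

Set Implicit Arguments.
Unset Strict Implicit.
Unset Printing Implicit Defensive.

(** * The rank of a product of differences of labels *)

Section Rank.
Import GRing.Theory mpoly.
Local Open Scope ring_scope.

(** If [D] is smaller than [A], the rows of [P] indexed by [A] are linearly dependent, and
    multiplying by [Q] preserves the dependency. *)
Lemma card_le_of_factorization (F : fieldType) (R D : finType) (A : {set R})
    (P : R -> D -> F) (Q : D -> R -> F) :
  (forall l : R -> F, (forall s, s \notin A -> l s = 0) ->
     (forall t, t \in A -> \sum_s l s * (\sum_d P s d * Q d t) = 0) ->
     forall s, l s = 0) ->
  (#|A| <= #|D|)%N.
Proof.
move=> indep; rewrite leqNgt; apply/negP=> DA.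
pose M := \matrix_(i < #|A|, j < #|D|) P (enum_val i) (enum_val j).
have: kermx M != 0.
  rewrite kermx_eq0 -row_leq_rank -ltnNge.
  by rewrite (leq_ltn_trans (rank_leq_col M)).
case/rowV0Pn=> u /sub_kermxP uM /eqP[].
have /card_gt0P[s0 As0] : (0 < #|A|)%N by apply: leq_ltn_trans DA.
pose l s := if s \in A then u 0 (enum_rank_in As0 s) else 0.
have l0 : forall s, l s = 0.
  apply: indep => [s /negPf nA|t tA]; first by rewrite /l nA.
  under eq_bigr do rewrite mulr_sumr; rewrite exchange_big big1 //= => d _.
  under eq_bigr do rewrite mulrA; rewrite -mulr_suml.
  suff -> : \sum_s l s * P s d = 0 by rewrite mul0r.
  have /matrixP/(_ 0 (enum_rank d)) := uM; rewrite !mxE => {2}<-.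
  rewrite (bigID (mem A)) /= [X in _ + X]big1 ?addr0; last first.
    by move=> s /negPf nA; rewrite /l nA mul0r.
  rewrite big_enum_val; apply: eq_bigr => i _.
  by rewrite /l enum_valP enum_valK_in mxE enum_rankK.
apply/rowP=> i; rewrite mxE -(l0 (enum_val i)) /l enum_valP.
by rewrite enum_valK_in.
Qed.

(** One indeterminate per label keeps distinct labels distinct and lets a minor be tested by
    specialization. *)
Definition label_field (L : finType) : fieldType := {fraction {mpoly rat[#|L|]}}.

Definition label (L : finType) (l : L) : label_field L :=
  tofrac (mpolyX rat (mnm1 (enum_rank l))).

Lemma label_inj (L : finType) : injective (@label L).
Proof.
move=> l m /eqP; rewrite tofrac_eq => /eqP/(congr1 (mcoeff (mnm1 (enum_rank l)))).
rewrite !mcoeffX eqxx => /esym/eqP; rewrite Num.Theory.eqr_nat eqb1 eq_mnm1.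
by move/eqP/enum_rank_inj.
Qed.

Definition label_prod (L I : finType) (a b : I -> L) : label_field L :=
  \prod_j (label (a j) - label (b j)).

Lemma label_prod_eq0 (L I : finType) (a b : I -> L) :
  (label_prod a b == 0) = [exists j, a j == b j].
Proof.
apply/prodf_eq0/existsP => -[j].
  by rewrite subr_eq0 => _ /eqP/label_inj e; exists j; apply/eqP.
by move=> /eqP e; exists j; rewrite // e subrr.
Qed.

(* Specialize the label of [b i] to that of [a i] and all others to distinct
   rationals: the left side vanishes, the right one does not. *)
Lemma label_minor_neq (L I : finType) (a a' b b' : I -> L) i :
  (forall j, a j != b' j) -> (forall j, a' j != b j) ->
  a i != b i -> a' i != a i -> b' i != b i ->
  (forall j, j != i -> b i \notin [:: a j; a' j; b j; b' j]) ->
  label_prod a b * label_prod a' b' != label_prod a b' * label_prod a' b.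
Proof.
move=> ab' a'b ab aa' bb' sep.
pose v l : rat := if l == b i then (enum_rank (a i))%:R else (enum_rank l)%:R.
pose V (k : 'I_#|L|) := v (enum_val k).
pose Q (a b : I -> L) : {mpoly rat[#|L|]} :=
  \prod_j (mpolyX rat (mnm1 (enum_rank (a j))) - mpolyX rat (mnm1 (enum_rank (b j)))).
have QE c d : label_prod c d = tofrac (Q c d).
  by rewrite rmorph_prod; apply: eq_bigr => j _; rewrite rmorphB.
have ev c d : meval V (Q c d) = \prod_j (v (c j) - v (d j)).
  rewrite rmorph_prod; apply: eq_bigr => j _.
  by rewrite rmorphB /= !mevalXU /V !enum_rankK.
rewrite !QE -!rmorphM tofrac_eq; apply/eqP => /(congr1 (meval V)).
rewrite !rmorphM /= !ev => /eqP; rewrite [X in X * _ == _](bigD1 i) //=.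
have vb : v (b i) = (enum_rank (a i))%:R by rewrite /v eqxx.
have vn l : l != b i -> v l = (enum_rank l)%:R by rewrite /v => /negPf->.
have rk (l m : L) : l != m -> (enum_rank l)%:R != (enum_rank m)%:R :> rat.
  by rewrite Num.Theory.eqr_nat; apply: contraNneq => /ord_inj/enum_rank_inj->.
rewrite vb vn // subrr !mul0r eq_sym mulf_eq0; apply/negP.
rewrite negb_or; apply/andP; split; apply/prodf_neq0 => j _; rewrite subr_eq0.
  have [->|ji] := eqVneq j i; first by rewrite !vn // rk.
  move: (sep j ji); rewrite !inE !negb_or => /and4P[n1 n2 n3 n4].
  by rewrite !vn ?rk // eq_sym.
have [->|ji] := eqVneq j i; first by rewrite vb vn // rk.
move: (sep j ji); rewrite !inE !negb_or => /and4P[n1 n2 n3 n4].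
by rewrite !vn ?rk // eq_sym.
Qed.

(** This is the source of the rank bound: one term per subset of [I], each a factor depending on [a]
    times a factor depending on [b]. *)
Lemma label_prod_sum (L I : finType) (a b : I -> L) :
  label_prod a b = \sum_(J : {set I})
    (\prod_j (if j \in J then label (a j) else 1)) *
    (\prod_j (if j \in J then 1 else - label (b j))).
Proof.
rewrite /label_prod bigA_distr; apply: eq_bigr => J _.
rewrite -big_split; apply: eq_bigr => j _ /=.
by case: ifP; rewrite ?mulr1 ?mul1r.
Qed.

Lemma kernel_2x2 (F : fieldType) (l m k00 k01 k10 k11 : F) :
  l * k00 + m * k10 = 0 -> l * k01 + m * k11 = 0 ->
  k00 * k11 != k01 * k10 -> l = 0 /\ m = 0.
Proof.
rewrite -subr_eq0 => e0 e1 /negPf d.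
have dl : l * (k00 * k11 - k01 * k10) = 0.
  have -> : l * (k00 * k11 - k01 * k10) =
    (l * k00 + m * k10) * k11 - (l * k01 + m * k11) * k10 by ring.
  by rewrite e0 e1 !mul0r subr0.
have dm : m * (k00 * k11 - k01 * k10) = 0.
  have -> : m * (k00 * k11 - k01 * k10) =
    (l * k01 + m * k11) * k00 - (l * k00 + m * k10) * k01 by ring.
  by rewrite e0 e1 !mul0r subr0.
by split; apply/eqP; [move/eqP: dl|move/eqP: dm]; rewrite mulf_eq0 d orbF.
Qed.

End Rank.

(** * Structure of colorings without small covers *)

Lemma card_setU_leq (T : finType) (A B : {set T}) a b k :
  #|A| <= a -> #|B| <= b -> k <= #|A :&: B| -> #|A :|: B| <= a + b - k.
Proof. by have := cardsUI A B; lia. Qed.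

Lemma leq_card_setD1 (T : finType) (A : {set T}) x k : k < #|A| -> k <= #|A :\ x|.
Proof. by rewrite (cardsD1 x); case: (_ \in _) => //; apply: ltnW. Qed.

Section Profiles.

Variables (r : nat) (V : finType).
Implicit Types (Z : finType) (S T : {set 'I_r * V}).

Definition covers Z (h : Z -> 'I_r -> V) S : Prop :=
  forall z, exists i, (i, h z i) \in S.

Definition agreeing (X Y : finType) (f : X -> 'I_r -> V) (g : Y -> 'I_r -> V) : Prop :=
  forall x y, exists i, f x i = g y i.

(** Two sets are used because the labels of some [y] will serve as [S] and those of some [x] as [T],
    shared labels being counted once. *)
Definition no_small_cover (X Y : finType) (f : X -> 'I_r -> V) (g : Y -> 'I_r -> V) : Prop :=
  forall S T, covers f S -> covers g T -> 2 * r - 2 < #|S :|: T|.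

Definition profile Z (h : Z -> 'I_r -> V) z : {set 'I_r * V} :=
  [set (i, h z i) | i : 'I_r].

Definition swap_out Z (h : Z -> 'I_r -> V) z i p : {set 'I_r * V} :=
  p |: [set (j, h z j) | j in [set~ i]].

Definition same_block Z (h : Z -> 'I_r -> V) i v j w : Prop :=
  forall z, (h z i == v) = (h z j == w).

Definition common_block Z (h : Z -> 'I_r -> V) i v : Prop :=
  forall j, exists w, same_block h i v j w.

(** A single [j] serves both sides, as [label_minor_neq] requires for a nonzero 2 by 2 minor. *)
Definition thick (X Y : finType) (f : X -> 'I_r -> V) (g : Y -> 'I_r -> V) i v :=
  [exists x, exists x', exists y, exists y', exists j,
    [&& [&& f x i == v, f x' i == v, g y i == v & g y' i == v],
        j != i, f x j != f x' j & g y j != g y' j]].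

Lemma agreeing_sym (X Y : finType) (f : X -> 'I_r -> V) (g : Y -> 'I_r -> V) :
  agreeing f g -> agreeing g f.
Proof. by move=> fg y x; have [i e] := fg x y; exists i. Qed.

Lemma no_small_cover_sym (X Y : finType) (f : X -> 'I_r -> V) (g : Y -> 'I_r -> V) :
  no_small_cover f g -> no_small_cover g f.
Proof. by move=> nc S T cS cT; rewrite setUC; apply: nc. Qed.

Lemma card_profile Z (h : Z -> 'I_r -> V) z : #|profile h z| <= r.
Proof. by rewrite (leq_trans (leq_imset_card _ _)) // card_ord. Qed.

Lemma card_others Z (h : Z -> 'I_r -> V) z (i : 'I_r) :
  #|[set (j, h z j) | j in [set~ i]]| <= r.-1.
Proof. by rewrite (leq_trans (leq_imset_card _ _)) // cardsC1 card_ord. Qed.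

Lemma card_swap_out Z (h : Z -> 'I_r -> V) z i p : #|swap_out h z i p| <= r.
Proof.
have r0 : 0 < r by rewrite (leq_trans _ (ltn_ord i)).
rewrite cardsU1 -[leqRHS](prednK r0) -add1n leq_add ?card_others //.
by case: (_ \notin _).
Qed.

Lemma mem_profile Z (h : Z -> 'I_r -> V) z i : (i, h z i) \in profile h z.
Proof. by apply: imset_f. Qed.

Lemma mem_swap_out Z (h : Z -> 'I_r -> V) z i p j :
  j != i -> (j, h z j) \in swap_out h z i p.
Proof. by move=> ji; apply/setU1P; right; apply: imset_f; rewrite !inE. Qed.

End Profiles.

Section CoversFromVertices.

Variables (r : nat) (V X Y : finType) (f : X -> 'I_r -> V) (g : Y -> 'I_r -> V).
Hypothesis fg : agreeing f g.
Hypothesis nc : no_small_cover f g.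

Lemma covers_profile x : covers g (profile f x).
Proof. by move=> y; have [i e] := fg x y; exists i; rewrite -e mem_profile. Qed.

Lemma covers_swap_out x i j v :
  (forall y, g y i = f x i -> g y j = v) -> covers g (swap_out f x i (j, v)).
Proof.
move=> sub y; have [k e] := fg x y; have [ki|ki] := eqVneq k i.
  by exists j; rewrite (sub y) -?ki ?e // setU11.
by exists k; rewrite -e mem_swap_out.
Qed.

(** A second shared label would bring the union down to [2 * r - 2]. *)
Lemma shared_unique S T p q : covers f S -> covers g T -> #|S| <= r -> #|T| <= r ->
  p \in S -> p \in T -> q \in S -> q \in T -> p = q.
Proof.
move=> cS cT rS rT pS pT qS qT; apply/eqP; apply: contraT => pq.
have := nc cS cT; rewrite ltnNge => /negP[].
apply: leq_trans (card_setU_leq (k := 2) rS rT _) _; last by lia.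
have -> : 2 = #|[set p; q]| by rewrite cards2 pq.
apply: subset_leq_card; apply/subsetP=> z; rewrite !inE.
by case/orP=> /eqP->; apply/andP.
Qed.

End CoversFromVertices.

Section Structure.

Variables (r : nat) (V X Y : finType) (f : X -> 'I_r -> V) (g : Y -> 'I_r -> V).
Hypothesis fg : agreeing f g.
Hypothesis nc : no_small_cover f g.
Let gf := agreeing_sym fg.

Lemma agree_unique x y i j : f x i = g y i -> f x j = g y j -> i = j.
Proof.
move=> ei ej.
have [] // : (i, g y i) = (j, g y j).
apply: (shared_unique nc (covers_profile gf y) (covers_profile fg x)).
- exact: card_profile.
- exact: card_profile.
- exact: mem_profile.
- by rewrite -ei mem_profile.
- exact: mem_profile.
- by rewrite -ej mem_profile.
Qed.

(** Otherwise the [r - 1] labels of [x] in the other colors already cover Y. They share one with the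
    [r] labels of [y0], which leaves only [2 * r - 2] in all. *)
Lemma spanning (y0 : Y) x i : exists y, g y i = f x i.
Proof.
have [/existsP[y /eqP]|/existsPn none] := boolP [exists y, g y i == f x i].
  by exists y.
set S := [set (j, f x j) | j in [set~ i]].
have memS j : j != i -> (j, f x j) \in S by move=> ji; apply: imset_f; rewrite !inE.
have cS : covers g S.
  move=> y; have [j e] := fg x y; exists j; rewrite -e memS //.
  by apply/eqP=> ji; case/eqP: (none y); rewrite -ji e.
have [j e] := fg x y0.
have ji : j != i by apply/eqP=> ji; case/eqP: (none y0); rewrite -ji e.
have := nc (covers_profile gf y0) cS; rewrite ltnNge => /negP[].
apply: leq_trans (card_setU_leq (k := 1) (card_profile g y0) (card_others f x i) _) _.
  by apply/card_gt0P; exists (j, f x j); rewrite inE {1}e mem_profile memS.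
by have := ltn_ord i; lia.
Qed.

(* Otherwise some y in the larger block lies outside the smaller one; trading
   the label (i, f x i) of x for (j, v) still covers Y, and then shares two
   labels with y. *)
Lemma antichain x i j v : i != j ->
  (forall y, g y i = f x i -> g y j = v) -> same_block g i (f x i) j v.
Proof.
move=> ij sub y; apply/eqP/eqP; first exact: sub.
move=> yj; apply/eqP; apply: contraT => yi.
have vx : v != f x j.
  apply: contraNneq ij => vx; have [y' y'i] := spanning y x i.
  by apply/eqP/(@agree_unique x y'); rewrite // (sub _ y'i).
have [k e] := fg x y.
have kj : k != j by apply: contraNneq vx => kj; rewrite -kj -yj e kj.
have ki : k != i by apply: contraNneq yi => <-; rewrite e.
suff [/eqP] : (k, g y k) = (j, g y j) by rewrite (negPf kj).
apply: (shared_unique nc (covers_profile gf y) (covers_swap_out fg sub)).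
- exact: card_profile.
- exact: card_swap_out.
- exact: mem_profile.
- by rewrite -e mem_swap_out.
- exact: mem_profile.
- by rewrite yj setU11.
Qed.

(* Trading the common label of x and y for (k, g y k) among the labels of x and
   for (j, f x j) among those of y makes both of these labels common. *)
Lemma not_mixed x y i j k : f x i = g y i -> j != i -> k != i ->
  same_block f i (f x i) j (f x j) -> same_block g i (g y i) k (g y k) -> False.
Proof.
move=> e ji ki sf sg.
suff [jk] : (j, f x j) = (k, g y k).
  by rewrite -jk => /(agree_unique e) ij; rewrite ij eqxx in ji.
apply: (@shared_unique _ _ _ _ _ _ nc (swap_out g y i (j, f x j))
         (swap_out f x i (k, g y k))).
- by apply: covers_swap_out => // x' x'i; apply/eqP; rewrite -sf e x'i.
- by apply: covers_swap_out => // y' y'i; apply/eqP; rewrite -sg -e y'i.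
- exact: card_swap_out.
- exact: card_swap_out.
- exact: setU11.
- exact: mem_swap_out.
- exact: mem_swap_out.
- exact: setU11.
Qed.

Lemma common_color x y i : common_block g i (g y i) ->
  exists c, same_block g i (g y i) c (f x c).
Proof.
move=> com; have [c e] := fg x y; have [w sw] := com c; exists c.
by have := sw y; rewrite eqxx e => /esym/eqP ->.
Qed.

(** By pigeonhole some [x] and [x'] in different blocks of color [i] agree with [y0] in one color
    [k]. Four colors of [x] are then accounted for, so at most a fifth is free: it must cut out the
    block [w] of [x'], and all blocks still left must equal the block of [x] in color [k]. At least
    two are left. *)
Lemma two_common_blocks i yB yC : 3 < r <= 5 -> 2 * r - 1 <= #|[set f x i | x : X]| ->
  common_block g i (g yB i) -> common_block g i (g yC i) -> g yB i = g yC i.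
Proof.
move=> /andP[r4 r5] wide comB comC; apply/eqP; apply: contraT => BC.
set T := [set f x i | x : X] in wide.
pose T' := T :\ g yB i :\ g yC i.
(* Here [3 < r] enters: [2 * r - 3] blocks outnumber the [r] colors. *)
have cT' : r < #|T'| by apply/leq_card_setD1/leq_card_setD1; lia.
have T'P v : v \in T' -> exists x, [/\ f x i = v, v != g yB i & v != g yC i].
  by rewrite !inE => /and3P[vC vB /imsetP[x _ e]]; exists x.
have /card_gt0P[v0 v0T] : 0 < #|T'| by lia.
have [x0 [x0v0 v0B v0C]] := T'P _ v0T.
have [y0 y0v0] := spanning yB x0 i; rewrite x0v0 in y0v0.
pose rep v := odflt x0 [pick x | f x i == v].
have repP v : v \in T' -> f (rep v) i = v.
  move=> /T'P[x [xv _ _]]; rewrite /rep; case: pickP => [x' /eqP //|/(_ x)].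
  by rewrite xv eqxx.
pose col v := odflt i [pick k | f (rep v) k == g y0 k].
have colP v : f (rep v) (col v) = g y0 (col v).
  rewrite /col; case: pickP => [k /eqP //|none].
  by have [k e] := fg (rep v) y0; have := none k; rewrite e eqxx.
have [v [w [vT wT vw kk]]] :
    exists v w, [/\ v \in T', w \in T', v != w & col v = col w].
  have: ~~ [forall v in T', forall w in T', (col v == col w) ==> (v == w)].
    apply/negP=> inj; suff: #|T'| <= #|'I_r| by rewrite card_ord; lia.
    rewrite -(@card_in_imset _ _ col T') ?max_card // => v w vT wT e.
    move/forall_inP/(_ v vT)/forall_inP/(_ w wT): inj; rewrite e eqxx.
    by move/eqP.
  rewrite negb_forall_in => /exists_inP[v vT].
  rewrite negb_forall_in => /exists_inP[w wT].
  by rewrite negb_imply => /andP[/eqP ? ?]; exists v, w.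
set k := col v in kk.
have [x [x' [xv x'w xk x'k]]] : exists x x',
    [/\ f x i = v, f x' i = w, f x k = g y0 k & f x' k = g y0 k].
  exists (rep v), (rep w); split; [exact: repP|exact: repP|exact: colP|].
  by rewrite kk colP.
clear repP colP; have [_ [_ vB vC]] := T'P _ vT; have [_ [_ wB wC]] := T'P _ wT.
have ki : k != i by apply: contraNneq vw => e; rewrite -xv -x'w -e xk x'k.
have [cB sB] := common_color x comB; have [cC sC] := common_color x comC.
have dBC : cB != cC.
  apply: contraNneq BC => e; have := sB yB; rewrite eqxx e -sC.
  by move=> <-.
have dB : cB != i by apply: contraNneq vB => e; have := sB yB; rewrite eqxx e xv eq_sym.
have dC : cC != i by apply: contraNneq vC => e; have := sC yC; rewrite eqxx e xv eq_sym.
have kB : cB != k by apply: contraNneq v0B => e; rewrite -y0v0 sB e xk.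
have kC : cC != k by apply: contraNneq v0C => e; rewrite -y0v0 sC e xk.
(* At most one color lies outside [cB], [cC], [i], [k], since r <= 5. *)
have fifth d d' : d \notin [:: cB; cC; i; k] -> d' \notin [:: cB; cC; i; k] -> d = d'.
  move=> nd nd'; apply/eqP; apply: contraT => dd'.
  have: uniq [:: d; d'; cB; cC; i; k].
    rewrite /= !inE !negb_or in nd nd' *.
    by rewrite dd' nd nd' dBC dB dC kB kC eq_sym ki.
  move=> /uniq_leq_size/(_ (fun z _ => mem_enum 'I_r z)).
  by rewrite size_enum_ord leqNgt ltnS r5.
have outside u y d : u \in T' -> u != v -> g y i = u -> f x d = g y d ->
    d \notin [:: cB; cC; i].
  move=> /T'P[_ [_ uB uC]] uv yu e; rewrite !inE !negb_or; apply/and3P; split.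
  - by apply: contraNneq uB => dB'; rewrite -yu sB -dB' e.
  - by apply: contraNneq uC => dC'; rewrite -yu sC -dC' e.
  - by apply: contraNneq uv => di; rewrite -yu -di -e di xv.
(* In color [k], [x] and [x'] have the same label, so [y] would agree with [x'] in both [i] and
   [k]. *)
have wcol y d : g y i = w -> f x d = g y d -> d \notin [:: cB; cC; i; k].
  move=> yw e; have := outside w y d wT _ yw e; rewrite eq_sym vw => /(_ isT).
  rewrite !inE !negb_or => /and3P[-> -> ->] /=.
  apply: contraNneq ki => dk; apply/eqP/(@agree_unique x' y).
    by rewrite x'k -xk -dk.
  by rewrite x'w yw.
have [yw ywi] := spanning yB x' i; have [d xd] := fg x yw.
have dP := wcol yw d (etrans ywi x'w) xd.
have sw : same_block g i w d (f x d).
  rewrite -x'w; apply: antichain => [|y yi].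
    by apply: contraNneq dP => <-; rewrite !inE eqxx !orbT.
  have [d' e] := fg x y; have d'P := wcol y d' (etrans yi x'w) e.
  by rewrite (fifth d d').
(* The fifth color is used up by the block [w], so only [k] remains for [u]. *)
have inE2 u : u \in T' -> u != v -> u != w -> same_block g i u k (f x k).
  move=> uT uv uw; have [xu [xui _ _]] := T'P _ uT; rewrite -xui.
  apply: antichain => [|y yi]; first by rewrite eq_sym.
  have yu := etrans yi xui; have [d' e] := fg x y.
  have := outside u y d' uT uv yu e.
  have d'd : d' != d by apply: contraNneq uw => d'd; rewrite -yu sw -d'd e.
  have [<- // |d'k] := eqVneq d' k.
  move=> nd'; case/eqP: d'd; apply: fifth => //.
  by move: nd'; rewrite !inE !negb_or d'k => /and3P[-> -> ->].
have : 1 < #|T' :\ v :\ w| by apply/leq_card_setD1/leq_card_setD1/(leq_trans r4)/ltnW.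
case/card_gt1P=> u [u' []] /setD1P[uw /setD1P[uv uT]] /setD1P[u'w /setD1P[u'v u'T]] /eqP[].
have [xu [xui _ _]] := T'P _ uT; have [y yi] := spanning yB xu i.
have := inE2 u uT uv uw y.
by rewrite -(inE2 u' u'T u'v u'w y) yi xui eqxx => /esym/eqP.
Qed.

(** * Rank bound on the number of components of one color *)

Section Width.
Import GRing.Theory.
Local Open Scope ring_scope.

(** One row and column per component, and a second pair per thick one, give a nonsingular block
    diagonal submatrix. Its rank is at most the number of sets of colors other than [i]. *)
Lemma width_bound (x0 : X) (y0 : Y) i (T := [set f x i | x : X]) :
  (#|T| + #|[set v in T | thick f g i v]| <= 2 ^ r.-1)%N.
Proof.
set Th := [set v in T | _].
pose I := {j : 'I_r | j != i}.
have cardD : #|{set I}| = (2 ^ r.-1)%N.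
  rewrite -cardsT -powersetT card_powerset cardsT card_sig.
  by rewrite (eq_card (B := [set~ i])) ?cardsC1 ?card_ord // => j; rewrite !inE.
rewrite -cardD.
(* The boolean tells the first row of a component from the second, which only thick components
   have. *)
pose A := setX T [set false] :|: setX Th [set true].
have <- : #|A| = (#|T| + #|Th|)%N.
  have dis : setX T [set false] :&: setX Th [set true] = set0.
    by apply/setP=> -[v []]; rewrite !inE ?andbF.
  by rewrite cardsU dis cards0 subn0 !cardsX !cards1 !muln1.
(* Tagging labels with their color makes indeterminates of different colors distinct. *)
pose a x (j : I) := (val j, f x (val j)); pose b y (j : I) := (val j, g y (val j)).
have K0 x y : f x i != g y i -> label_prod (a x) (b y) = 0.
  move=> ne; apply/eqP; rewrite label_prod_eq0; apply/existsP.
  have [j e] := fg x y; have ji : j != i by apply: contraNneq ne => <-; rewrite e.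
  by exists (Sub j ji); rewrite /a /b /= e.
have sep x y (j : I) : f x i = g y i -> a x j != b y j.
  move=> e; apply/eqP=> -[ej]; have := valP j.
  by rewrite /= (agree_unique ej e) eqxx.
have K1 x y : f x i = g y i -> label_prod (a x) (b y) != 0.
  move=> e; rewrite label_prod_eq0; apply/existsPn => j; exact: sep.
have uP v : exists u : (X * X) * (Y * Y), v \in T ->
    [/\ f u.1.1 i = v, f u.1.2 i = v, g u.2.1 i = v, g u.2.2 i = v &
     v \in Th -> exists j, [/\ j != i, f u.1.1 j != f u.1.2 j &
                              g u.2.1 j != g u.2.2 j]].
  have [|nvT] := boolP (v \in T); last by exists ((x0, x0), (y0, y0)).
  case/imsetP=> x _ xv; have [vTh|nvTh] := boolP (v \in Th).
    move: vTh; rewrite !inE => /andP[_].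
    case/existsP=> x1 /existsP[x2 /existsP[y1 /existsP[y2 /existsP[j]]]].
    case/andP=> /and4P[/eqP ? /eqP ? /eqP ? /eqP ?] /and3P[? ? ?].
    by exists ((x1, x2), (y1, y2)) => _; split=> // _; exists j.
  by have [y yi] := spanning y0 x i; exists ((x, x), (y, y)) => _; rewrite xv yi.
have {uP}[u uP] := fin_all_exists uP.
pose xs (s : V * bool) := if s.2 then (u s.1).1.2 else (u s.1).1.1.
pose ys (s : V * bool) := if s.2 then (u s.1).2.2 else (u s.1).2.1.
have xsP v c : v \in T -> f (xs (v, c)) i = v by case: c => /uP[].
have ysP v c : v \in T -> g (ys (v, c)) i = v by case: c => /uP[].
have AT s : s \in A -> s.1 \in T.
  by case: s => v c; rewrite !inE /= => /orP[/andP[]|/andP[/andP[]]].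
apply: (@card_le_of_factorization _ _ _ _
  (fun s (J : {set I}) => \prod_j (if j \in J then label (a (xs s) j) else 1))
  (fun (J : {set I}) t => \prod_j (if j \in J then 1 else - label (b (ys t) j)))).
move=> l supp eqs.
have {}eqs v c : (v, c) \in A ->
    l (v, false) * label_prod (a (xs (v, false))) (b (ys (v, c))) +
    l (v, true) * label_prod (a (xs (v, true))) (b (ys (v, c))) = 0.
  move=> vcA; rewrite -[RHS](eqs _ vcA).
  under [RHS]eq_bigr do rewrite -label_prod_sum.
  rewrite (bigD1 (v, false)) //= (bigD1 (v, true)) ?xpair_eqE ?andbF //=.
  rewrite big1 ?addr0 // => -[w d] /andP[nf nt].
  have [wA|wA] := boolP ((w, d) \in A); last by rewrite supp // mul0r.
  rewrite K0 ?mulr0 // xsP ?(AT _ wA) // ysP ?(AT _ vcA) //.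
  by apply: contraTneq nf => wv; case: d nt {wA}; rewrite wv ?eqxx.
case=> v c; have [vcA|] := boolP ((v, c) \in A); last exact: supp.
have vT : v \in T := AT _ vcA; have [xv xv' yv yv' vth] := uP v vT.
have vfA : (v, false) \in A by rewrite !inE /= vT.
have [vTh|nvTh] := boolP (v \in Th); last first.
  have lt : l (v, true) = 0.
    by apply: supp; rewrite in_setU !in_setX /= (negPf nvTh) !inE /= andbF.
  case: c {vcA}; first exact: lt.
  have /eqP := eqs _ _ vfA; rewrite lt mul0r addr0 mulf_eq0.
  by rewrite (negPf (K1 _ _ _)) ?orbF ?xsP ?ysP // => /eqP.
have vtA : (v, true) \in A by rewrite in_setU !in_setX /= vTh !inE /= orbT.
have [j [ji dx dy]] := vth vTh.
suff [l0 l1] : l (v, false) = 0 /\ l (v, true) = 0 by case: c {vcA}.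
apply: (kernel_2x2 (eqs _ _ vfA) (eqs _ _ vtA)).
apply: (@label_minor_neq _ _ _ _ _ _ (Sub j ji)).
- by move=> k; apply: sep; rewrite xsP ?ysP.
- by move=> k; apply: sep; rewrite xsP ?ysP.
- by apply: sep; rewrite xsP ?ysP.
- by rewrite /a /xs /= xpair_eqE eqxx eq_sym.
- by rewrite /b /ys /= xpair_eqE eqxx eq_sym.
- move=> k /negPf kj; rewrite !inE /a /b !xpair_eqE /= !negb_or.
  by rewrite -[j]/(val (Sub j ji : I)) (inj_eq val_inj) eq_sym kj.
Qed.

End Width.

End Structure.

(** For [r] = 2, 3 already [t <= 2 ^ r.-1] fails. Otherwise [n >= 2 * t - 2 ^ r.-1], which is at
    least 6 for [r] = 4 and 2 for [r] = 5. *)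
Lemma width_arith r t h n : 1 < r <= 5 -> 2 * r - 2 < t ->
  t + h <= 2 ^ r.-1 -> t = h + n -> 3 < r /\ 1 < n.
Proof. by case: r => [|[|[|[|[|[|r]]]]]] //=; rewrite ?expnS ?expn0; lia. Qed.

(** * Components that are not thick, and the contradiction *)

Section Assembly.

Variables (r : nat) (V X Y : finType) (f : X -> 'I_r -> V) (g : Y -> 'I_r -> V).
Hypothesis fg : agreeing f g.
Hypothesis nc : no_small_cover f g.
Let gf := agreeing_sym fg.
Let nc' := no_small_cover_sym nc.

(** In each other color one side of the component is constant, hence a full block by [antichain];
    [not_mixed] forces the same side for all colors. *)
Lemma thin_common x y i : f x i = g y i -> ~~ thick f g i (f x i) ->
  common_block f i (f x i) \/ common_block g i (g y i).
Proof.
move=> e thin.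
have const j : j != i -> (forall x', f x' i = f x i -> f x' j = f x j) \/
                         (forall y', g y' i = g y i -> g y' j = g y j).
  move=> ji.
  have [/existsP[x' /andP[/eqP x'i x'j]]|/existsPn fc] :=
      boolP [exists x', (f x' i == f x i) && (f x' j != f x j)]; [right|left].
    move=> y' y'i; apply/eqP; apply: contraNT thin => y'j.
    apply/existsP; exists x; apply/existsP; exists x'.
    apply/existsP; exists y; apply/existsP; exists y'.
    apply/existsP; exists j; rewrite x'i y'i e !eqxx ji /=.
    by rewrite (eq_sym (f x j)) x'j eq_sym y'j.
  by move=> x' x'i; have := fc x'; rewrite x'i eqxx /= negbK => /eqP.
have fblock j : j != i -> (forall x', f x' i = f x i -> f x' j = f x j) ->
    same_block f i (f x i) j (f x j).
  by rewrite e => ji; apply: (antichain gf nc'); rewrite eq_sym.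
have gblock j : j != i -> (forall y', g y' i = g y i -> g y' j = g y j) ->
    same_block g i (g y i) j (g y j).
  by rewrite -e => ji; apply: (antichain fg nc); rewrite eq_sym.
have [/forallP gc|] := boolP [forall j, (j != i) ==>
    [forall y', (g y' i == g y i) ==> (g y' j == g y j)]].
  right=> j; have [->|ji] := eqVneq j i; first by exists (g y i).
  exists (g y j); apply: gblock => // y' /eqP y'i.
  by move: (gc j); rewrite ji => /forallP/(_ y'); rewrite y'i => /eqP.
case/forallPn=> j; rewrite negb_imply => /andP[ji /forallPn[y']].
rewrite negb_imply => /andP[/eqP y'i y'j].
have fj : same_block f i (f x i) j (f x j).
  by case: (const j ji) => [/(fblock _ ji) //|/(_ y' y'i)/eqP]; rewrite (negPf y'j).
left=> k; have [->|ki] := eqVneq k i; first by exists (f x i).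
exists (f x k); case: (const k ki) => [/(fblock _ ki) //|/(gblock _ ki) gk].
by case: (not_mixed fg nc e ji ki fj gk).
Qed.

(** In a color [j] where [x] and [y] agree, their component would have both its X-block and its
    Y-block as blocks of color [i]. *)
Lemma not_both_common x y i : f x i != g y i ->
  common_block f i (f x i) -> common_block g i (g y i) -> False.
Proof.
move=> ne comf comg; have [j e] := fg x y.
have ij : i != j by apply: contraNneq ne => ->; apply/eqP.
have [w sf] := comf j; have [w' sg] := comg j.
have wE : f x j = w by apply/eqP; rewrite -sf.
have w'E : g y j = w' by apply/eqP; rewrite -sg.
apply: (not_mixed fg nc e ij ij) => z; first by rewrite wE sf.
by rewrite w'E sg.
Qed.

Lemma images_eq (x0 : X) (y0 : Y) i :
  [set f x i | x : X] = [set g y i | y : Y].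
Proof.
apply/setP=> v; apply/imsetP/imsetP=> -[z _ ->].
  by have [y <-] := spanning fg nc y0 z i; exists y.
by have [x <-] := spanning gf nc' x0 z i; exists x.
Qed.

Lemma width_gt (x0 : X) (y0 : Y) i : 2 * r - 2 < #|[set f x i | x : X]|.
Proof.
have <- : #|setX [set i] [set f x i | x : X]| = #|[set f x i | x : X]|.
  by rewrite cardsX cards1 mul1n.
rewrite -[setX _ _]setUid; apply: nc => z; exists i; rewrite in_setX set11 /=.
  exact: imset_f.
by rewrite (images_eq x0 y0); apply: imset_f.
Qed.

Lemma no_small_cover_absurd (x0 : X) (y0 : Y) : 1 < r <= 5 -> False.
Proof.
case/andP=> r1 r5; pose i := Ordinal r1.
have wide := width_gt x0 y0 i; have bound := width_bound fg nc x0 y0 i.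
set T := [set f x i | x : X] in wide bound.
pose N := [set v in T | ~~ thick f g i v].
have TN : #|T| = #|[set v in T | thick f g i v]| + #|N|.
  rewrite -(cardsID [set v | thick f g i v] T); congr (_ + _); apply: eq_card => v.
    by rewrite !inE.
  by rewrite !inE andbC.
have r25 : 1 < r <= 5 by rewrite r1.
have [r4 N2] := width_arith r25 wide bound TN.
have NP v : v \in N -> exists x y, [/\ f x i = v, g y i = v &
    common_block f i (f x i) \/ common_block g i (g y i)].
  rewrite inE => /andP[/imsetP[x _ ->] thin].
  have [y yi] := spanning fg nc y0 x i.
  by exists x, y; split=> //; apply: thin_common.
have r45 : 3 < r <= 5 by rewrite r4.
have wide' : 2 * r - 1 <= #|T| by apply: leq_trans wide; lia.
have wideg : 2 * r - 1 <= #|[set g y i | y : Y]| by rewrite -(images_eq x0 y0).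
case/card_gt1P: N2 => v [w [/NP[x [y [xv yv cv]]] /NP[x' [y' [x'w y'w cw]]] /eqP vw]].
case: cv cw => cv [] cw.
- by apply: vw; rewrite -xv -x'w; apply: (two_common_blocks gf nc').
- by apply: (@not_both_common x y' i) => //; rewrite xv y'w; apply/eqP.
- by apply: (@not_both_common x' y i) => //; rewrite x'w yv eq_sym; apply/eqP.
- by apply: vw; rewrite -yv -y'w; apply: (two_common_blocks fg nc).
Qed.

End Assembly.

Lemma small_cover r (V X Y : finType) (f : X -> 'I_r -> V) (g : Y -> 'I_r -> V) :
  1 < r <= 5 -> 0 < #|X| -> 0 < #|Y| -> agreeing f g ->
  exists S, [/\ covers f S, covers g S & #|S| <= 2 * r - 2].
Proof.
move=> hr /card_gt0P[x0 _] /card_gt0P[y0 _] fg.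
pose cov (Z : finType) (h : Z -> 'I_r -> V) (S : {set 'I_r * V}) :=
  [forall z, exists i, (i, h z i) \in S].
have covP (Z : finType) (h : Z -> 'I_r -> V) S : reflect (covers h S) (cov Z h S).
  by apply: (iffP forallP) => cS z; apply/existsP; apply: cS.
have [/existsP[S /and3P[/covP ? /covP ? ?]]|/existsPn none] :=
    boolP [exists S, [&& cov _ f S, cov _ g S & #|S| <= 2 * r - 2]].
  by exists S.
case: (@no_small_cover_absurd _ _ _ _ f g fg _ x0 y0 hr) => S T cS cT.
rewrite ltnNge; apply: contra (none (S :|: T)) => small.
apply/and3P; split=> //; apply/covP=> z.
  by have [i iS] := cS z; exists i; rewrite in_setU iS.
by have [i iT] := cT z; exists i; rewrite in_setU iT orbT.
Qed.

(** * From labels to monochromatic components *)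

Section MonochromaticComponents.

Variables (X Y : finType) (r : nat) (c : X -> Y -> 'I_r).

Lemma mono_adj_sym i : symmetric (mono_adj c i).
Proof. by case=> [x|y] [x'|y']. Qed.

Definition comp_label i (u : X + Y) : X + Y := fingraph.root (mono_adj c i) u.

Lemma comp_labelP i u v :
  reflect (comp_label i u = comp_label i v) (connect (mono_adj c i) u v).
Proof. exact/fingraph.rootP/sym_connect_sym/mono_adj_sym. Qed.

(* A label whose vertex is isolated in the given color is realized by a
   component of another color at the same vertex. *)
Definition realized_color i v :=
  if [exists w, mono_adj c i v w] then i
  else odflt i [pick j | [exists w, mono_adj c j v w]].

Definition realize (p : 'I_r * (X + Y)) : {set X + Y} :=
  [set u | connect (mono_adj c (realized_color p.1 p.2)) p.2 u].

Lemma realize_component p : 0 < #|X| -> 0 < #|Y| -> mono_component c (realize p).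
Proof.
case: p => i v /card_gt0P[x0 _] /card_gt0P[y0 _].
exists (realized_color i v); exists v => //; apply/existsP.
rewrite /realized_color; case: ifP => // _; case: pickP => //= none.
case: v none => [x|y] none.
  by have /existsP[] := none (c x y0); exists (inr y0) => /=.
by have /existsP[] := none (c x0 y); exists (inl x0) => /=.
Qed.

Lemma mem_realize i u : u \in realize (i, comp_label i u).
Proof.
rewrite inE /=; set v := comp_label i u.
have : connect (mono_adj c i) v u.
  by apply/comp_labelP/fingraph.root_root/sym_connect_sym/mono_adj_sym.
(* If [v] is isolated in color [i], then [u] is [v] itself, so a component of any color at [v]
   contains it. *)
rewrite /realized_color; case: ifP => // iso.
case/connectP=> -[_ ->|w p /= /andP[vw _] _]; first exact: connect0.
by case/existsP: iso; exists w.
Qed.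

End MonochromaticComponents.

Theorem theorem1 (r : nat) (hr : r \in [:: 2; 3; 4; 5])
    (X Y : finType) (hX : 0 < #|X|) (hY : 0 < #|Y|) (c : X -> Y -> 'I_r) :
  exists C : {set {set X + Y}},
    [/\ forall A : {set X + Y}, A \in C -> mono_component c A,
        #|C| <= 2 * r - 2
      & cover C = [set: X + Y]].
Proof.
pose f x i := comp_label c i (inl x); pose g y i := comp_label c i (inr y).
have r25 : 1 < r <= 5 by move: hr; rewrite !inE => /or4P[] /eqP->.
have [|S [cX cY small]] := @small_cover r _ X Y f g r25 hX hY.
  by move=> x y; exists (c x y); apply/comp_labelP/connect1 => /=.
exists [set realize c p | p in S]; split.
- by move=> A /imsetP[p _ ->]; apply: realize_component.
- exact: leq_trans (leq_imset_card _ _) small.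
apply/setP=> u; rewrite inE; have [i iS] : exists i, (i, comp_label c i u) \in S.
  by case: u => [x|y]; [apply: cX|apply: cY].
apply/bigcupP; exists (realize c (i, comp_label c i u)); first exact: imset_f.
exact: mem_realize.
Qed.
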